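(* Let $\ast$ and $\vartriangle$ be two arbitrary binary operations on $[0,1]$. The convolution $\ast_\vartriangle$ is a $t_r$-norm on $(\mathbf{L},\sqsubseteq)$ if and only if it is a t-norm on $(\mathbf{L},\sqsubseteq)$.
   Context: $\mathbf{M}$ is the set of all functions $[0,1]\to[0,1]$; $\wedge$ denotes minimum. For binary operations $\ast,\vartriangle$ on $[0,1]$, the convolution $\ast_\vartriangle:\mathbf{M}^2\to\mathbf{M}$ is $(f\ast_\vartriangle g)(x)=\sup\{f(y)\vartriangle g(z)\mid y,z\in[0,1],\ y\ast z=x\}$, with $\sup\varnothing=0$. The relation $\sqsubseteq$ is: $f\sqsubseteq g$ iff $f\wedge_\wedge g=f$ (where $\wedge_\wedge$ is the convolution with $\ast=\vartriangle=\wedge$). $f\in\mathbf{M}$ is normal if $\sup_{x}f(x)=1$, and convex if $x\le y\le z$ implies $f(x)\wedge f(z)\le f(y)$. $\mathbf{L}$ is the set of all normal convex elements of $\mathbf{M}$. For $A\subseteq[0,1]$, $\bar A$ (or $\overline{A}$) is the characteristic function of $A$, and $\bar a$ is that of $\{a\}$. $(\mathbf{L},\sqsubseteq)$ is a bounded poset with least element $\bar 0$ and greatest element $\bar 1$. $\mathbf{J}=\{\bar x\mid x\in[0,1]\}$ and $\mathbf{J}^{[2]}=\{\overline{[a,b]}\mid 0\le a\le b\le1\}$; these are subsets of $\mathbf{L}$. A t-norm on a bounded poset $(P,\le,0_P,1_P)$ is a binary operation $P^2\to P$ that is associative, commutative, monotone increasing in each argument, and has unit $1_P$. A $t_r$-norm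 on $(\mathbf{L},\sqsubseteq)$ is a t-norm $T:\mathbf{L}^2\to\mathbf{L}$ on $(\mathbf{L},\sqsubseteq)$ such that $T$ is closed on $\mathbf{J}$ and on $\mathbf{J}^{[2]}$ (i.e. $T(\mathbf{J}^2)\subseteq\mathbf{J}$ and $T(\mathbf{J}^{[2]}\times\mathbf{J}^{[2]})\subseteq\mathbf{J}^{[2]}$), and $T(\overline{[0,1]},\overline{[a,b]})=\overline{[0,b]}$ for all $0\le a\le b\le 1$. ''$\ast_\vartriangle$ is a t-norm ($t_r$-norm) on $(\mathbf{L},\sqsubseteq)$'' means that $\ast_\vartriangle$ maps $\mathbf{L}^2$ into $\mathbf{L}$ and its restriction is a t-norm ($t_r$-norm). *)

(* Defs.v *)
From HB Require Import structures.
From mathcomp Require Import all_boot all_order all_algebra.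
From mathcomp Require Import boolp classical_sets reals interval_inference.

Set Implicit Arguments.
Unset Strict Implicit.
Unset Printing Implicit Defensive.
Import Order.TTheory GRing.Theory Num.Theory.
Local Open Scope classical_set_scope.
Local Open Scope ring_scope.

(* {i01 R} is the unit interval [0,1] of R, with the order of R. *)
Definition M (R : realType) : Type := {i01 R} -> {i01 R}.

(* The default value of [supremum] realizes the convention sup of the empty
   set = 0; by num_sup01 every subset of [0,1] has its genuine supremum. *)
Definition sup01 (R : realType) (A : set {i01 R}) : {i01 R} :=
  supremum (0%:i01 : {i01 R}) A.

Lemma num_sup01 (R : realType) (A : set {i01 R}) :
  (sup01 A)%:num = sup [set x%:num | x in A].
Proof.
have [->|/eqP/set0P[a Aa]] := pselect (A = set0).
  by rewrite /sup01 supremum0 image_set0 sup0.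
set B := [set x%:num | x in A].
have B0 : B !=set0 by exists a%:num, a.
have B1 : ubound B 1 by move=> _ [x _ <-]; exact: le1.
have supB : has_sup B by split=> //; exists 1.
have s0 : 0 <= sup B.
  apply: (@le_trans _ _ a%:num); first exact: ge0.
  by apply: (sup_upper_bound supB); exists a.
have s1 : sup B <= 1 by exact: ge_sup.
suff -> : sup01 A = Itv01 s0 s1 by [].
rewrite /sup01 /supremum ifF; last by apply/eqP => A0; move: Aa; rewrite A0.
apply: xget_subset1; last exact: is_subset1_supremums.
split=> [x Ax|y yA].
  by apply: (sup_upper_bound supB); exists x.
by apply: ge_sup => // _ [x Ax <-]; exact: yA.
Qed.

Definition conv (R : realType) (star tri : {i01 R} -> {i01 R} -> {i01 R})
    (f g : M R) : M R :=
  fun x => sup01 [set tri (f p.1) (g p.2) |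
                  p in [set p : {i01 R} * {i01 R} | star p.1 p.2 = x]].

Definition min01 (R : realType) (x y : {i01 R}) : {i01 R} := Order.min x y.

Definition sqle (R : realType) (f g : M R) : Prop :=
  conv (@min01 R) (@min01 R) f g = f.

Definition normal (R : realType) (f : M R) : Prop :=
  sup01 (range f) = 1%:i01.

Definition convex (R : realType) (f : M R) : Prop :=
  forall x y z : {i01 R}, x <= y -> y <= z -> min01 (f x) (f z) <= f y.

Definition L (R : realType) : set (M R) := [set f | normal f /\ convex f].

Definition char (R : realType) (A : set {i01 R}) : M R :=
  fun x => if x \in A then 1%:i01 else 0%:i01.

Definition char_pt (R : realType) (a : {i01 R}) : M R := char [set a].

Definition char_itv (R : realType) (a b : {i01 R}) : M R :=
  char [set x | a <= x <= b].

Definition J (R : realType) : set (M R) := range (@char_pt R).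

Definition J2 (R : realType) : set (M R) :=
  [set f | exists a b : {i01 R}, a <= b /\ f = char_itv a b].

(* [op], given on the whole of T, maps P x P into P and its restriction to P is
   a t-norm on the poset P ordered by [le] with greatest element [top].
   "Increasing" is meant in the weak sense. *)
Definition is_tnorm (T : Type) (P : set T) (le : T -> T -> Prop) (top : T)
    (op : T -> T -> T) : Prop :=
  [/\ forall x y, P x -> P y -> P (op x y),
      forall x y z, P x -> P y -> P z -> op x (op y z) = op (op x y) z,
      forall x y, P x -> P y -> op x y = op y x,
      forall x y z, P x -> P y -> P z -> le x y ->
        le (op x z) (op y z) /\ le (op z x) (op z y)
    & forall x, P x -> op top x = x /\ op x top = x].

Definition is_tnorm_L (R : realType) (op : M R -> M R -> M R) : Prop :=
  is_tnorm (@L R) (@sqle R) (char_pt 1%:i01) op.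

Definition is_trnorm_L (R : realType) (op : M R -> M R -> M R) : Prop :=
  [/\ is_tnorm_L op,
      forall f g, J f -> J g -> J (op f g),
      forall f g, J2 f -> J2 g -> J2 (op f g)
    & forall a b : {i01 R}, a <= b ->
        op (char_itv 0%:i01 1%:i01) (char_itv a b) = char_itv 0%:i01 b].

(* Main.v *)
Require Import Defs.
From mathcomp Require Import all_boot all_order all_algebra.
From mathcomp Require Import boolp classical_sets reals interval_inference.

(** Testing the unit law [T 1 f = f = T f 1] on characteristic functions of
    points forces [tri] to act on {0, 1} as the Boolean conjunction. Hence [T]
    sends the characteristic functions of [A] and [B] to that of
    [A * B = {y * z | y in A, z in B}]. On points this makes [star] a monotone
    operation with unit 1. An interval product [[a, b] * [c, d]] therefore has
    least element [a * c] and greatest element [b * d], and it is convex because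
    [T] preserves [L]; so it is the closed interval [[a * c, b * d]], without
    any continuity of [star]. *)

Set Implicit Arguments.
Unset Strict Implicit.
Unset Printing Implicit Defensive.
Import Order.TTheory GRing.Theory Num.Theory.
Local Open Scope classical_set_scope.
Local Open Scope ring_scope.

Section Supremum.
Variable R : realType.
Implicit Types (A : set {i01 R}) (x y : {i01 R}).

Lemma i01_ge0 x : 0%:i01 <= x.
Proof. by rewrite -num_le /=; exact: ge0. Qed.

Lemma i01_le1 x : x <= 1%:i01.
Proof. by rewrite -num_le /=; exact: le1. Qed.

Lemma i01_10 : (1%:i01 : {i01 R}) <> 0%:i01.
Proof. by move/(congr1 (fun x : {i01 R} => x%:num))/eqP; rewrite /= oner_eq0. Qed.

(** At such a point the characteristic functions of 0 and of 1 both vanish, which [tnorm_boolean]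
    exploits. *)
Lemma i01_between : exists h : {i01 R}, h <> 0%:i01 /\ h <> 1%:i01.
Proof.
have h0 : (0 : R) <= 2^-1 by rewrite invr_ge0.
have h1 : 2^-1 <= 1 :> R by rewrite invf_le1 ?ler1n.
exists (Itv01 h0 h1); split=> /(congr1 (fun x : {i01 R} => x%:num))/eqP /=.
  by rewrite invr_eq0 pnatr_eq0.
by rewrite invr_eq1 pnatr_eq1.
Qed.

Lemma sup01_ub A x : A x -> x <= sup01 A.
Proof.
move=> Ax; rewrite -num_le num_sup01; apply: ub_le_sup; last by exists x.
by exists 1 => _ [y _ <-]; exact: le1.
Qed.

Lemma sup01_le A y : (forall x, A x -> x <= y) -> sup01 A <= y.
Proof.
(* The empty set obeys the bound too, since its supremum is 0 by convention. *)
move=> Ay; have [->|/eqP/set0P[a Aa]] := pselect (A = set0).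
  by rewrite /sup01 supremum0; exact: i01_ge0.
rewrite -num_le num_sup01; apply: ge_sup; first by exists a%:num, a.
by move=> _ [x Ax <-]; rewrite num_le; exact: Ay.
Qed.

Lemma sup01_eq1 A : A 1%:i01 -> sup01 A = 1%:i01.
Proof. by move=> A1; apply/le_anti; rewrite i01_le1 sup01_ub. Qed.

Lemma sup01_eq0 A : (forall x, A x -> x = 0%:i01) -> sup01 A = 0%:i01.
Proof.
move=> A0; apply/le_anti; rewrite i01_ge0 andbT.
by apply: sup01_le => x /A0 ->.
Qed.

End Supremum.

Section Characteristic.
Variable R : realType.
Implicit Types (A B : set {i01 R}) (a b x y z : {i01 R}).
Implicit Types (star tri : {i01 R} -> {i01 R} -> {i01 R}).

Lemma char1 A x : A x -> char A x = 1%:i01.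
Proof. by move=> Ax; rewrite /char mem_set. Qed.

Lemma char0 A x : ~ A x -> char A x = 0%:i01.
Proof. by move=> Ax; rewrite /char memNset. Qed.

Lemma char_eq1 A x : char A x = 1%:i01 -> A x.
Proof. by have [//|/char0 ->] := pselect (A x) => /esym/i01_10. Qed.

Lemma char_neq0 A x : char A x <> 0%:i01 -> A x.
Proof. by have [//|/char0 ->] := pselect (A x). Qed.

Lemma char_inj : injective (@char R).
Proof.
move=> A B AB; apply/seteqP; split=> x /char1.
  by rewrite AB => /char_eq1.
by rewrite -AB => /char_eq1.
Qed.

Lemma char_in_L A : A !=set0 ->
  (forall x y z, A x -> A z -> x <= y -> y <= z -> A y) -> L (char A).
Proof.
move=> [a Aa] Aconv; split; first by apply: sup01_eq1; exists a; rewrite ?char1.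
move=> x y z xy yz; have [Ax|/char0 ->] := pselect (A x); last first.
  by rewrite /min01 ge_min i01_ge0.
have [Az|/char0 ->] := pselect (A z); last by rewrite /min01 ge_min i01_ge0 orbT.
by rewrite (char1 (Aconv _ _ _ Ax Az xy yz)) i01_le1.
Qed.

Lemma L_char_convex A x y z :
  L (char A) -> A x -> A z -> x <= y -> y <= z -> A y.
Proof.
move=> [_ cA] Ax Az xy yz; have := cA _ _ _ xy yz.
rewrite (char1 Ax) (char1 Az) /min01 minxx => A1.
by apply: char_eq1; apply/le_anti; rewrite i01_le1.
Qed.

Lemma char_pt_in_L a : L (char_pt a).
Proof.
apply: char_in_L; first by exists a.
by move=> _ y _ -> -> ay ya; apply/le_anti; rewrite ay ya.
Qed.

Lemma char_itv_in_L a b : a <= b -> L (char_itv a b).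
Proof.
move=> ab; apply: char_in_L; first by exists a; rewrite /= lexx.
move=> x y z /= /andP[ax _] /andP[_ zb] xy yz.
by rewrite (le_trans ax xy) (le_trans yz zb).
Qed.

Lemma conv_ge star tri (f g : M R) y z :
  tri (f y) (g z) <= conv star tri f g (star y z).
Proof. by apply: sup01_ub; exists (y, z). Qed.

(** Characteristic functions feed only 0 and 1 to [tri], so its other values stay unconstrained. *)
Definition boolean_conjunction tri : Prop :=
  [/\ tri 0%:i01 0%:i01 = 0%:i01, tri 0%:i01 1%:i01 = 0%:i01,
      tri 1%:i01 0%:i01 = 0%:i01 & tri 1%:i01 1%:i01 = 1%:i01].

Definition set_op star A B : set {i01 R} :=
  [set x | exists y z, [/\ A y, B z & star y z = x]].

(** Every term of the supremum is 0 or 1, and it is 1 exactly for a pair in A x B. *)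
Lemma conv_char star tri A B : boolean_conjunction tri ->
  conv star tri (char A) (char B) = char (set_op star A B).
Proof.
move=> [t00 t01 t10 t11]; apply/funext => x.
have [AB|nAB] := pselect (set_op star A B x).
  rewrite (char1 AB); apply: sup01_eq1; case: AB => y [z [Ay Bz yz]].
  by exists (y, z); rewrite //= !char1.
rewrite (char0 nAB); apply: sup01_eq0 => _ [[y z] /= yz <-].
have [Ay|/char0 ->] := pselect (A y); have [Bz|/char0 ->] := pselect (B z);
  rewrite ?char1 //.
by case: nAB; exists y, z.
Qed.

Lemma conv_char_pt star tri a b : boolean_conjunction tri ->
  conv star tri (char_pt a) (char_pt b) = char_pt (star a b).
Proof.
move=> tri01; rewrite /char_pt conv_char//; congr char.
by apply/seteqP; split=> [_ [_ [_ [-> -> <-]]]//|_ ->]; exists a, b.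
Qed.

Lemma char_pt_inj : injective (@char_pt R).
Proof. by move=> a b /char_inj ab; have : [set b] a by rewrite -ab. Qed.

Lemma min01_boolean : boolean_conjunction (@min01 R).
Proof. by split; rewrite /min01 ?minxx//; [rewrite min_l|rewrite min_r]; rewrite ?i01_ge0. Qed.

(** Convolving two points under the minimum gives the point [min01 a b]. This carries monotonicity
    between [T] and [star]. *)
Lemma sqle_char_pt a b : sqle (char_pt a) (char_pt b) <-> a <= b.
Proof.
rewrite /sqle conv_char_pt; last exact: min01_boolean.
split=> [/char_pt_inj <-|ab]; first by rewrite /min01 ge_min lexx orbT.
by rewrite /min01 min_l.
Qed.

End Characteristic.

Section Tnorm.
Variables (R : realType) (star tri : {i01 R} -> {i01 R} -> {i01 R}).
Hypothesis T_tnorm : is_tnorm_L (conv star tri).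
Implicit Types (a b c d : {i01 R}).

Let unitl a : conv star tri (char_pt 1%:i01) (char_pt a) = char_pt a.
Proof. by case: T_tnorm => _ _ _ _ /(_ _ (char_pt_in_L a))[]. Qed.

Let unitr a : conv star tri (char_pt a) (char_pt 1%:i01) = char_pt a.
Proof. by case: T_tnorm => _ _ _ _ /(_ _ (char_pt_in_L a))[]. Qed.

(** The value of [tri] here is one of the terms whose supremum is T(1, a) = a at [star y z]; if
    nonzero, it puts [star y z] in the support {a}. *)
Lemma unitl_support a y z :
  tri (char_pt 1%:i01 y) (char_pt a z) <> 0%:i01 -> star y z = a.
Proof.
move=> n0; apply: (@char_neq0 _ [set a]) => c0; apply: n0; apply/le_anti.
by rewrite i01_ge0 andbT -c0 -[char _]/(char_pt a) -[in leRHS]unitl; exact: conv_ge.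
Qed.

Lemma unitr_support a y z :
  tri (char_pt a y) (char_pt 1%:i01 z) <> 0%:i01 -> star y z = a.
Proof.
move=> n0; apply: (@char_neq0 _ [set a]) => c0; apply: n0; apply/le_anti.
by rewrite i01_ge0 andbT -c0 -[char _]/(char_pt a) -[in leRHS]unitr; exact: conv_ge.
Qed.

Lemma tnorm_boolean : boolean_conjunction tri.
Proof.
have [h [h0 h1]] := i01_between R.
have n01 : (0%:i01 : {i01 R}) <> 1%:i01 by move=> /esym/i01_10.
have pt a : char_pt a a = 1%:i01 by exact: char1.
have npt a b : b <> a -> char_pt a b = 0%:i01 by move=> ba; exact: char0.
(* In each of the three cases, one pair of arguments produces the same value of [tri] for a = 0 and
   for a = 1. Were that value nonzero, the product of the pair would equal both 0 and 1. *)
have t00 : tri 0%:i01 0%:i01 = 0%:i01.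
  apply: contrapT => t00; apply: (n01).
  transitivity (star 0%:i01 h); first by apply/esym/unitl_support; rewrite !npt.
  by apply: unitl_support; rewrite !npt.
have t01 : tri 0%:i01 1%:i01 = 0%:i01.
  apply: contrapT => t01; apply: (n01).
  transitivity (star h 1%:i01).
    by apply/esym/unitr_support; rewrite npt// pt.
  by apply: unitr_support; rewrite npt// pt.
have t10 : tri 1%:i01 0%:i01 = 0%:i01.
  apply: contrapT => t10; apply: (n01).
  transitivity (star 1%:i01 h).
    by apply/esym/unitl_support; rewrite pt npt.
  by apply: unitl_support; rewrite pt npt.
(* The unit law at 1 writes 1 as a supremum of values of [tri] on {0, 1}. All but [tri 1 1] are
   already 0, so 1 is at most [tri 1 1]. *)
split=> //; apply/le_anti; rewrite i01_le1 -{1}(pt 1%:i01) -{1}unitl /=.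
apply: sup01_le => _ [[y z] /= _ <-].
have [->|/npt ->] := pselect (y = 1%:i01); have [->|/npt ->] := pselect (z = 1%:i01);
  by rewrite ?pt ?t00 ?t01 ?t10 ?i01_ge0.
Qed.

Lemma star1x a : star 1%:i01 a = a.
Proof. by apply: char_pt_inj; rewrite -(conv_char_pt _ _ _ tnorm_boolean). Qed.

Lemma starx1 a : star a 1%:i01 = a.
Proof. by apply: char_pt_inj; rewrite -(conv_char_pt _ _ _ tnorm_boolean). Qed.

Lemma star_le a b c d : a <= b -> c <= d -> star a c <= star b d.
Proof.
case: T_tnorm => _ _ _ mono _ /sqle_char_pt ab /sqle_char_pt cd.
have L_pt := @char_pt_in_L R.
(* One argument moves at a time, through [star b c]. *)
have [+ _] := mono _ _ _ (L_pt a) (L_pt b) (L_pt c) ab.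
have [_ +] := mono _ _ _ (L_pt c) (L_pt d) (L_pt b) cd.
rewrite !conv_char_pt; try exact: tnorm_boolean.
by move=> /sqle_char_pt bcd /sqle_char_pt /le_trans; exact.
Qed.

(** By monotonicity, 0 * a <= 0 * 1 = 0. *)
Lemma star0x a : star 0%:i01 a = 0%:i01.
Proof.
apply/le_anti; rewrite i01_ge0 andbT -{2}(starx1 0%:i01).
exact: star_le (i01_le1 a).
Qed.

Lemma conv_char_itv a b c d : a <= b -> c <= d ->
  conv star tri (char_itv a b) (char_itv c d) =
  char_itv (star a c) (star b d).
Proof.
move=> ab cd; case: T_tnorm => closed _ _ _ _.
have := closed _ _ (char_itv_in_L ab) (char_itv_in_L cd).
rewrite /char_itv conv_char; last exact: tnorm_boolean.
move=> Lab; congr char; apply/seteqP; split=> [_ [y [z [/andP[ay yb] /andP[cz zd] <-]]]|x].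
  by rewrite /= !star_le.
(* Both endpoints are products, so convexity of the product set supplies every point between
   them. *)
case/andP; apply: (L_char_convex Lab).
  by exists a, c; rewrite /= !lexx.
by exists b, d; rewrite /= !lexx ab cd.
Qed.

End Tnorm.

Theorem theorem3p5 (R : realType) (star tri : {i01 R} -> {i01 R} -> {i01 R}) :
  is_trnorm_L (conv star tri) <-> is_tnorm_L (conv star tri).
Proof.
split=> [[]//|T_tnorm]; split=> //.
- move=> _ _ [a _ <-] [b _ <-]; exists (star a b) => //.
  by rewrite conv_char_pt//; exact: (tnorm_boolean T_tnorm).
- move=> _ _ [a [b [ab ->]]] [c [d [cd ->]]].
  exists (star a c), (star b d); split; first exact: (star_le T_tnorm).
  exact: conv_char_itv.
(* [0, 1] * [a, b] = [0 * a, 1 * b] = [0, b]. *)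
- move=> a b ab; rewrite conv_char_itv ?i01_ge0//.
  by rewrite (star0x T_tnorm) (star1x T_tnorm).
Qed.
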